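(* Let $f,g:\mathbb R^n\to\mathbb R$ be convex and continuous, let $\mathcal Z\subseteq\mathbb R^n$ be convex and compact with diameter $D$, and let $\epsilon_f,\epsilon_g>0$. By scaling $\tilde g^\circ=\frac{\epsilon_f}{\epsilon_g}\tilde g$ and applying FC-BiO$^{\mathrm{Lip}}$ or FC-BiO$^{\mathrm{sm}}$ (defined in the context) to the functions $f$ and $\tilde g^\circ$, an $(\epsilon_f,\epsilon_g)$-weak optimal solution of the simple bilevel problem $\min_{x\in\mathcal Z}f(x)$ s.t. $x\in\arg\min_{z\in\mathcal Z}g(z)$ is obtained within an iteration complexity of $$\tilde{\mathcal O}\left(\max\left\{\frac{C_f^2}{\epsilon_f^2},\frac{C_g^2}{\epsilon_g^2}\right\}D^2\right)$$ (using FC-BiO$^{\mathrm{Lip}}$) if $f$ and $g$ are $C_f$- and $C_g$-Lipschitz on $\mathcal Z$ respectively, and $$\tilde{\mathcal O}\left(\max\left\{\sqrt{\frac{L_f}{\epsilon_f}},\sqrt{\frac{L_g}{\epsilon_g}}\right\}D\right)$$ (using FC-BiO$^{\mathrm{sm}}$) if $f$ and $g$ are $L_f$- and $L_g$-smooth respectively.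
   Context: Notation: $g^*=\min_{z\in\mathcal Z}g(z)$, $\mathcal X_g^*=\arg\min_{z\in\mathcal Z}g(z)$, $f^*=\min_{x\in\mathcal X_g^*}f(x)$. A point $\hat x$ is an $(\epsilon_f,\epsilon_g)$-weak optimal solution if $f(\hat x)-f^*\le\epsilon_f$ and $g(\hat x)-g^*\le\epsilon_g$. $L$-smooth means differentiable with $L$-Lipschitz gradient. $\Pi_{\mathcal Z}$ is Euclidean projection onto $\mathcal Z$. Initialization: a point $\hat x_g\in\mathcal Z$ with $g^*\le g(\hat x_g)\le g^*+\epsilon_g/2$ is available; $\hat g^*=g(\hat x_g)$, $\tilde g(x)=g(x)-\hat g^*$, $\hat f^*=\min\{f(x):x\in\mathcal Z,\tilde g(x)\le0\}$. Initial bounds: $u=f(\hat x_g)$ and some $\ell\le\hat f^*$. FC-BiO applied to $f$ and a constraint function $h$ (here $h=\tilde g^\circ$), with accuracy $\epsilon$ (here $\epsilon=\epsilon_f$) and $T$ iterations in total: let $\psi(t,x)=\max\{f(x)-t,h(x)\}$. Set $N=\lceil\log_2\frac{u-\ell}{\epsilon/2}\rceil$, $K=T/N$ (an integer), $\bar x=x_0\in\mathcal Z$. Repeat $N$ times: $t=(\ell+u)/2$; run a subroutine from $\bar x$ for $K$ iterations to get $\hat x_{(t)}$ and $\hat\psi^*(t)=\psi(t,\hat x_{(t)})$; set $\bar x=\hat x_{(t)}$; if $\hat\psi^*(t)>\epsilon/2$ set $\ell=t$, else $u=t$. Return $\hat x_{(u)}$ for the final $u$, with $\hat x_{(u)}=\hat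 x_g$ if $u$ has its initial value. FC-BiO$^{\mathrm{Lip}}$ subroutine: let $C$ be the larger of the Lipschitz constants of $f$ and $h$, $\eta=D/(C\sqrt K)$; for $k=0,\dots,K-1$ take a subgradient $s$ of $\psi(t,\cdot)$ at $x_k$ (one of $f$ if $f(x_k)-t>h(x_k)$, one of $h$ if $<$, a convex combination if equal) and set $x_{k+1}=\Pi_{\mathcal Z}(x_k-\eta s)$; output $\frac1K\sum_{k=0}^{K-1}x_k$. The subgradients of $f$ and $g$ used at points of $\mathcal Z$ are understood to have norm at most $C_f$ and $C_g$. FC-BiO$^{\mathrm{sm}}$ subroutine: let $L$ be the larger of the smoothness constants of $f$ and $h$, $y_0=x_0$, $\alpha_0=\frac12$; for $k=0,\dots,K-1$ let $x_{k+1}=\arg\min_{x\in\mathcal Z}\max\{f(y_k)+\langle\nabla f(y_k),x-y_k\rangle+\frac L2\|x-y_k\|_2^2-t,\ h(y_k)+\langle\nabla h(y_k),x-y_k\rangle+\frac L2\|x-y_k\|_2^2\}$, let $\alpha_{k+1}\in(0,1)$ solve $\alpha_{k+1}^2=(1-\alpha_{k+1})\alpha_k^2$, $\beta_k=\frac{\alpha_k(1-\alpha_k)}{\alpha_k^2+\alpha_{k+1}}$, $y_{k+1}=x_{k+1}+\beta_k(x_{k+1}-x_k)$; output $x_K$. Complexity is the total number $T$ of subroutine iterations; $\tilde{\mathcal O}$ hides universal constants and logarithmic factors (such as $\log\frac{u-\ell}{\epsilon_f}$, with $\ell,u$ the initial bounds). *)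

(* Defs.v *)
From HB Require Import structures.
From mathcomp Require Import all_boot all_order all_algebra.
From mathcomp Require Import all_classical all_reals all_analysis.
Import Order.TTheory GRing.Theory Num.Theory.
Import numFieldNormedType.Exports.

Set Implicit Arguments.
Unset Strict Implicit.
Unset Printing Implicit Defensive.

Local Open Scope classical_set_scope.
Local Open Scope ring_scope.

Section Euclidean.
Context {R : realType} {n : nat}.
Implicit Types (x y z s p : 'rV[R]_n) (f : 'rV[R]_n -> R) (Z : set 'rV[R]_n).

Definition dotp x y : R := \sum_(i < n) x ord0 i * y ord0 i.

(* The norm `|x| of the library on row vectors is the sup norm; it induces the
   same topology, but all metric notions below are Euclidean. *)
Definition enorm x : R := Num.sqrt (dotp x x).

Definition diameter Z : R :=
  sup [set r | exists x y, [/\ Z x, Z y & r = enorm (x - y)]].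

Definition is_proj Z x p : Prop :=
  Z p /\ forall z, Z z -> enorm (x - p) <= enorm (x - z).

Definition subgradient f x s : Prop :=
  forall y, f x + dotp s (y - x) <= f y.

Definition bounded_subgradient (C : R) f x s : Prop :=
  subgradient f x s /\ enorm s <= C.

(* Meaningful where f is differentiable. *)
Definition grad f x : 'rV[R]_n :=
  \row_(i < n) 'D_(delta_mx ord0 i) (f : 'rV[R]_n -> R^o) x.

Definition lipschitz_in Z (C : R) f : Prop :=
  forall x y, Z x -> Z y -> `|f x - f y| <= C * enorm (x - y).

Definition smooth (L : R) f : Prop :=
  (forall x, differentiable (f : 'rV[R]_n -> R^o) x) /\
  (forall x y, enorm (grad f x - grad f y) <= L * enorm (x - y)).

Definition argmin_set Z f : set 'rV[R]_n :=
  [set z | Z z /\ forall w, Z w -> f z <= f w].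

(* The minimum of f over Z whenever it is attained, in particular for f
   continuous and Z compact and nonempty. *)
Definition min_on Z f : R := inf (f @` Z).

End Euclidean.

Section Bilevel.
Context {R : realType} {n : nat}.
Variables (f g : 'rV[R]_n -> R) (Z : set 'rV[R]_n).

Definition gstar : R := min_on Z g.

Definition fstar : R := min_on (argmin_set Z g) f.

Definition weak_optimal (ef eg : R) (x : 'rV[R]_n) : Prop :=
  f x - fstar <= ef /\ g x - gstar <= eg.

End Bilevel.

Section FCBiO.
Context {R : realType} {n : nat}.
Variables (f h : 'rV[R]_n -> R) (Z : set 'rV[R]_n).

Definition psi (t : R) (x : 'rV[R]_n) : R := Num.max (f x - t) (h x).

(* ceil(log2 ((u - l) / (eps / 2))), read as 0 repetitions when it is negative
   (and when u = l, since ln 0 = 0). *)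
Definition bisection_count (l u eps : R) : nat :=
  `|Num.max (0 : int) (Num.ceil (ln ((u - l) / (eps / 2)) / ln 2))|%N.

(* sub t xbar out: the subroutine run on psi t from xbar may return out.
   In bisection eps sub N l u xbar xu out, N is the number of repetitions left
   and xu is the point associated with the current upper bound u. *)
Inductive bisection (eps : R) (sub : R -> 'rV[R]_n -> 'rV[R]_n -> Prop) :
    nat -> R -> R -> 'rV[R]_n -> 'rV[R]_n -> 'rV[R]_n -> Prop :=
| bisection_done l u xbar xu :
    bisection eps sub 0 l u xbar xu xu
| bisection_lower N l u xbar xu xt out :
    sub ((l + u) / 2) xbar xt ->
    eps / 2 < psi ((l + u) / 2) xt ->
    bisection eps sub N ((l + u) / 2) u xt xu out ->
    bisection eps sub N.+1 l u xbar xu out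
| bisection_upper N l u xbar xu xt out :
    sub ((l + u) / 2) xbar xt ->
    psi ((l + u) / 2) xt <= eps / 2 ->
    bisection eps sub N l ((l + u) / 2) xt xt out ->
    bisection eps sub N.+1 l u xbar xu out.

Definition psi_subgradient (Cf Ch t : R) (x s : 'rV[R]_n) : Prop :=
  [\/ h x < f x - t /\ bounded_subgradient Cf f x s,
      f x - t < h x /\ bounded_subgradient Ch h x s
    | f x - t = h x /\
      exists (a : R) (s1 s2 : 'rV[R]_n),
        [/\ 0 <= a <= 1, bounded_subgradient Cf f x s1,
            bounded_subgradient Ch h x s2 & s = a *: s1 + (1 - a) *: s2]].

Definition lip_subroutine (D Cf Ch : R) (K : nat) (t : R)
    (x0 out : 'rV[R]_n) : Prop :=
  let eta := D / (Num.max Cf Ch * Num.sqrt K%:R) in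
  exists x s : nat -> 'rV[R]_n,
    [/\ x 0%N = x0,
        forall k, (k < K)%N -> psi_subgradient Cf Ch t (x k) (s k) /\
                               is_proj Z (x k - eta *: s k) (x k.+1)
      & out = K%:R^-1 *: \sum_(0 <= k < K) x k].

Definition quad_model (L : R) (phi : 'rV[R]_n -> R) (y x : 'rV[R]_n) : R :=
  phi y + dotp (grad phi y) (x - y) + L / 2 * enorm (x - y) ^+ 2.

Definition psi_model (L t : R) (y x : 'rV[R]_n) : R :=
  Num.max (quad_model L f y x - t) (quad_model L h y x).

Definition sm_subroutine (Lf Lh : R) (K : nat) (t : R)
    (x0 out : 'rV[R]_n) : Prop :=
  let L := Num.max Lf Lh in
  exists (x y : nat -> 'rV[R]_n) (alpha : nat -> R),
    [/\ x 0%N = x0 /\ y 0%N = x0, alpha 0%N = 1 / 2,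
        forall k, (k < K)%N ->
          [/\ argmin_set Z (psi_model L t (y k)) (x k.+1),
              0 < alpha k.+1 < 1,
              alpha k.+1 ^+ 2 = (1 - alpha k.+1) * alpha k ^+ 2
            & y k.+1 = x k.+1 +
                (alpha k * (1 - alpha k) / (alpha k ^+ 2 + alpha k.+1)) *:
                (x k.+1 - x k)]
      & out = x K].

(* K is the number of iterations of each of the subroutine runs, so that
   the total number of iterations is T = N * K with N = bisection_count l u eps. *)
Definition fcbio_lip (D Cf Ch eps l u : R) (x0 xg : 'rV[R]_n) (K : nat)
    (out : 'rV[R]_n) : Prop :=
  bisection eps (lip_subroutine D Cf Ch K) (bisection_count l u eps)
    l u x0 xg out.

Definition fcbio_sm (Lf Lh eps l u : R) (x0 xg : 'rV[R]_n) (K : nat)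
    (out : 'rV[R]_n) : Prop :=
  bisection eps (sm_subroutine Lf Lh K) (bisection_count l u eps)
    l u x0 xg out.

End FCBiO.

(* run K out: the method, with N calls of K iterations each, may return out.
   At most B iterations in total suffice for every possible output to be good,
   and a larger budget does no harm. *)
Definition complexity_le {R : realType} {T : Type}
    (run : nat -> T -> Prop) (good : T -> Prop) (N : nat) (B : R) : Prop :=
  exists K0 : nat,
    [/\ (0 < K0)%N, (N * K0)%:R <= B
      & forall (K : nat) (out : T), (K0 <= K)%N -> run K out -> good out].

(* The bound hidden by the soft-O of X: a universal constant c times
   a logarithmic factor in rho = (u - l) / eps; the maximum with 1 accounts for
   the iteration number of each call being a positive integer. *)
Definition softO {R : realType} (c rho X : R) : R :=
  c * (1 + ln (1 + rho)) * Num.max 1 X.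

(* Main.v *)
Require Import Defs.
From HB Require Import structures.
From mathcomp Require Import all_boot all_order all_algebra.
From mathcomp Require Import all_classical all_reals all_analysis.
From mathcomp Require Import ring lra.
Import Order.TTheory GRing.Theory Num.Theory.
Import numFieldNormedType.Exports.
Local Open Scope classical_set_scope.
Local Open Scope ring_scope.

(* Bisection in t keeps [l <= fF], where fF is the minimum of f over
   {z in Z : g z <= g xg}, and keeps [psi u xu <= ef / 2]: an (ef / 2)-accurate
   minimizer of psi t with value > ef / 2 certifies min psi t > 0, hence t < fF.
   After N halvings [u - l <= ef / 2], so [f xu <= fF + ef <= f^* + ef] and
   [h xu <= ef / 2], i.e. [g xu <= g xg + eg / 2 <= g^* + eg].

   It remains to bound the number K of iterations making one subroutine run
   (ef / 2)-accurate. For the subgradient method, telescoping |x_k - z|^2 bounds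
   the gap by D C / sqrt K. For the accelerated method,
   psi(x_(k+1)) - psi(z) + L / 2 |x_(k+1) - w_k|^2 <= 4 L D^2 alpha_k^2 with
   w_k = (1 - alpha_k) x_k + alpha_k z, by induction on k, and
   alpha_k <= 2 / (k + 4), which bounds the gap by 16 L D^2 / K^2. The induction
   starts after the first step, whose gap is at most L D^2 / 2, so the initial
   gap, which L and D do not control, never enters. *)

Set Implicit Arguments.
Unset Strict Implicit.

(** * Euclidean geometry: Cauchy-Schwarz, convex combinations, projections *)

Section Euclid.
Context {R : realType} {n : nat}.
Implicit Types (x y z p : 'rV[R]_n) (a b c : R) (Z : set 'rV[R]_n).

Lemma dotpC x y : dotp x y = dotp y x.
Proof. by apply: eq_bigr => i _; rewrite mulrC. Qed.

Lemma dotpDl x y z : dotp (x + y) z = dotp x z + dotp y z.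
Proof. by rewrite -big_split; apply: eq_bigr => i _; rewrite mxE mulrDl. Qed.

Lemma dotpZl a x y : dotp (a *: x) y = a * dotp x y.
Proof. by rewrite mulr_sumr; apply: eq_bigr => i _; rewrite mxE mulrA. Qed.

Lemma dotpDr x y z : dotp z (x + y) = dotp z x + dotp z y.
Proof. by rewrite ![dotp z _]dotpC dotpDl. Qed.

Lemma dotpZr a x y : dotp y (a *: x) = a * dotp y x.
Proof. by rewrite ![dotp y _]dotpC dotpZl. Qed.

Lemma dotpNl x y : dotp (- x) y = - dotp x y.
Proof. by rewrite -scaleN1r dotpZl mulN1r. Qed.

Lemma dotpNr x y : dotp y (- x) = - dotp y x.
Proof. by rewrite ![dotp y _]dotpC dotpNl. Qed.

Definition dotpE := (dotpDl, dotpDr, dotpZl, dotpZr, dotpNl, dotpNr).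

Lemma dotpBB x y :
  dotp (x - y) (x - y) = dotp x x - 2 * dotp x y + dotp y y.
Proof. rewrite !dotpE (dotpC y x); ring. Qed.

Lemma dotp_ge0 x : 0 <= dotp x x.
Proof. by apply: sumr_ge0 => i _; rewrite -expr2 sqr_ge0. Qed.

Lemma enorm_ge0 x : 0 <= enorm x.
Proof. exact: sqrtr_ge0. Qed.

Lemma enorm_sqr x : enorm x ^+ 2 = dotp x x.
Proof. by rewrite sqr_sqrtr // dotp_ge0. Qed.

Lemma enormN x : enorm (- x) = enorm x.
Proof. by rewrite /enorm !dotpE opprK. Qed.

Lemma enormZ a x : enorm (a *: x) = `|a| * enorm x.
Proof. by rewrite /enorm !dotpE mulrA -expr2 sqrtrM ?sqr_ge0// sqrtr_sqr. Qed.

(** The quadratic [|x - t y|^2] in [t] is nonnegative; its value at the minimizing [t] gives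
    Cauchy-Schwarz. *)
Lemma dotp_sqr_le x y : dotp x y ^+ 2 <= dotp x x * dotp y y.
Proof.
have Q t : 0 <= dotp x x - 2 * t * dotp x y + t ^+ 2 * dotp y y.
  have := dotp_ge0 (x - t *: y); rewrite dotpBB !(dotpZl, dotpZr).
  by congr (_ <= _); ring.
have [y0|y0] := eqVneq (dotp y y) 0.
  have [->|b0] := eqVneq (dotp x y) 0; first by rewrite y0 expr0n mulr0.
  (* With [dotp y y = 0] the quadratic is affine in [t]; this [t] would give it the negative value
     [- dotp x x - 2]. *)
  have := Q ((dotp x x + 1) / dotp x y).
  have -> : 2 * ((dotp x x + 1) / dotp x y) * dotp x y = 2 * (dotp x x + 1).
    by field.
  rewrite y0; have := dotp_ge0 x; lra.
have {}y0 : 0 < dotp y y by rewrite lt_neqAle eq_sym y0 dotp_ge0.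
rewrite -subr_ge0; have := mulr_ge0 (ltW y0) (Q (dotp x y / dotp y y)).
congr (_ <= _); field; exact: lt0r_neq0.
Qed.

Lemma dotp_le x y : dotp x y <= enorm x * enorm y.
Proof.
rewrite (le_trans (ler_norm _))// -sqrtr_sqr -sqrtrM ?dotp_ge0//.
by rewrite ler_wsqrtr// dotp_sqr_le.
Qed.

Lemma enormD x y : enorm (x + y) <= enorm x + enorm y.
Proof.
rewrite -(@ler_pXn2r _ 2)// ?nnegrE ?addr_ge0 ?enorm_ge0//.
rewrite sqrrD !enorm_sqr !dotpE (dotpC y x); have := dotp_le x y; lra.
Qed.

(** Replaces a limit [a -> 0]: an inequality along a segment is divided by its parameter [a], and
    the remainder [a * c] has to vanish. The choice [a = b / (2 c)] would give [b <= b / 2]. *)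
Lemma le0_of_le_small b c : (forall a, 0 < a <= 1 -> b <= a * c) -> b <= 0.
Proof.
move=> H; rewrite leNgt; apply/negP => b0.
have bc : b <= c by rewrite (le_trans (H 1 _)) ?mul1r// ltr01 lexx.
have c0 : 0 < c by apply: lt_le_trans bc.
have /H : 0 < b / (2 * c) <= 1.
  rewrite divr_gt0 ?mulr_gt0//= ler_pdivrMr ?mulr_gt0//; lra.
have -> : b / (2 * c) * c = b / 2 by field; exact: lt0r_neq0.
lra.
Qed.

Lemma convex_setP Z x y a : convex_set Z -> Z x -> Z y -> 0 <= a <= 1 ->
  Z ((1 - a) *: x + a *: y).
Proof.
move=> cZ Zx Zy /andP[a0 a1].
have := cZ y x (Itv01 a0 a1); rewrite !inE => /(_ Zy Zx) Zxy.
by rewrite addrC; exact: Zxy.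
Qed.

Lemma convex_fctP (f : 'rV[R]_n -> R) x y a : convex_function setT f ->
  0 <= a <= 1 -> f ((1 - a) *: x + a *: y) <= (1 - a) * f x + a * f y.
Proof.
move=> cf /andP[a0 a1].
have := cf (Itv01 a0 a1) y x; rewrite !inE => /(_ Logic.I Logic.I) fxy.
by rewrite addrC [leRHS]addrC; exact: fxy.
Qed.

(** First-order optimality: moving from [p] towards [z] does not reduce the distance to [x], and
    only the term linear in [a] survives as [a -> 0]. *)
Lemma is_proj_dotp_le0 Z x p z : convex_set Z -> is_proj Z x p -> Z z ->
  dotp (x - p) (z - p) <= 0.
Proof.
move=> cZ [Zp xp] Zz; rewrite -(pmulr_rle0 _ (ltr0n R 2)).
apply: (@le0_of_le_small _ (dotp (z - p) (z - p))) => a /andP[a0 a1].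
have Za : Z ((1 - a) *: p + a *: z) by apply: convex_setP => //; rewrite ltW.
have := xp _ Za; rewrite -(@ler_pXn2r _ 2)// ?nnegrE ?enorm_ge0// !enorm_sqr.
have -> : x - ((1 - a) *: p + a *: z) = (x - p) - a *: (z - p).
  by apply/rowP => i; rewrite !mxE; ring.
rewrite [leRHS]dotpBB !(dotpZl, dotpZr) => H.
rewrite -(ler_pM2l a0); lra.
Qed.

End Euclid.

(** * Continuity, attained extrema and the diameter *)

Section Topology.
Context {R : realType} {n : nat}.
Implicit Types (x y z p : 'rV[R]_n) (a b c : R) (Z : set 'rV[R]_n).

Lemma dotp_continuous y : continuous (fun x => dotp x y : R^o).
Proof.
rewrite (_ : (fun x => _) = \sum_(i < n) (fun x => x ord0 i * y ord0 i : R^o)).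
  elim/big_ind: _ => [x|g h cg ch x|i _ x].
  - exact: cst_continuous.
  - by apply: continuousD; [exact: cg|exact: ch].
  - by apply: (@cvgM _ _ (nbhs x)); [exact: coord_continuous|exact: cvg_cst].
by apply/funext => x; rewrite fct_sumE.
Qed.

Lemma enorm_sub_continuous y : continuous (fun x => enorm (x - y) : R^o).
Proof.
suff cq : continuous (fun x => dotp (x - y) (x - y) : R^o).
  move=> x.
  apply: (@continuous_comp _ R^o R^o (fun x => dotp (x - y) (x - y)) Num.sqrt).
    exact: cq.
  exact: sqrt_continuous.
rewrite (_ : (fun x => _) = \sum_(i < n)
    (fun x => (x ord0 i - y ord0 i) * (x ord0 i - y ord0 i) : R^o)).
  elim/big_ind: _ => [x|g h cg ch x|i _ x].
  - exact: cst_continuous.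
  - by apply: continuousD; [exact: cg|exact: ch].
  - have ci : {for x, continuous (fun x => x ord0 i - y ord0 i : R^o)}.
      by apply: continuousB; [exact: coord_continuous|exact: cst_continuous].
    exact: (@cvgM _ _ (nbhs x) _ _ _ _ _ ci ci).
by apply/funext => x; rewrite fct_sumE; apply: eq_bigr => i _; rewrite !mxE.
Qed.

Lemma quad_model_continuous (M : R) (phi : 'rV[R]_n -> R) y :
  continuous (quad_model M phi y : 'rV[R]_n -> R^o).
Proof.
rewrite (_ : quad_model M phi y =
  (cst (phi y - dotp y (grad phi y)) + (fun x => dotp x (grad phi y) : R^o)) +
  cst (M / 2) * (fun x => enorm (x - y) : R^o) ^+ 2); last first.
  apply/funext => x; rewrite /quad_model !fctE (dotpC (grad _ _)).
  rewrite dotpDl dotpNl /=. ring.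
have en := @enorm_sub_continuous y.
move=> x; apply: continuousD.
  by apply: continuousD; [exact: cst_continuous|exact: dotp_continuous].
apply: continuousM; first exact: cst_continuous.
by apply: continuousM; exact: en.
Qed.

Lemma argmin_set_nonempty Z (f : 'rV[R]_n -> R) : Z !=set0 -> compact Z ->
  continuous (f : 'rV[R]_n -> R^o) -> argmin_set Z f !=set0.
Proof.
move=> Z0 cZ cf; have [|p pZ pmin] := @EVT_min_rV R n f Z Z0 cZ.
  exact: continuous_subspaceT.
exists p; split; first by rewrite inE in pZ.
by move=> w Zw; apply: pmin; rewrite inE.
Qed.

Lemma min_on_argmin Z (f : 'rV[R]_n -> R) p : argmin_set Z f p ->
  min_on Z f = f p.
Proof.
move=> [Zp pmin]; apply/eqP; rewrite eq_le; apply/andP; split.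
  by apply: ge_inf; [exists (f p) => _ [w Zw <-]; exact: pmin|exists p].
by apply: lb_le_inf; [exists (f p), p|move=> _ [w Zw <-]; exact: pmin].
Qed.

Lemma is_proj_exists Z x : Z !=set0 -> compact Z -> exists p, is_proj Z x p.
Proof.
move=> Z0 cZ.
have [p [Zp pmin]] := argmin_set_nonempty Z0 cZ (@enorm_sub_continuous x).
exists p; split=> // z Zz.
by rewrite -enormN opprB -(enormN (x - z)) opprB pmin.
Qed.

Lemma enorm_le_diameter Z x y : compact Z -> Z x -> Z y ->
  enorm (x - y) <= diameter Z.
Proof.
move=> cZ Zx Zy; apply: ub_le_sup; last by exists x, y.
have Z0 : Z !=set0 by exists x.
have [p pZ pmax] := EVT_max_rV Z0 cZ
  (continuous_subspaceT (@enorm_sub_continuous x)).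
(* The supremum needs a bounded set: every point of [Z] is within [|p - x|] of [x], so twice that
   bounds all distances. *)
exists (enorm (p - x) + enorm (p - x)) => _ [v [w [Zv Zw ->]]].
have -> : v - w = (v - x) + - (w - x) by rewrite opprB subrKA.
by rewrite (le_trans (enormD _ _))// enormN lerD// pmax// inE.
Qed.

Lemma diameter_ge0 Z x : compact Z -> Z x -> 0 <= diameter Z.
Proof.
by move=> cZ Zx; rewrite (le_trans (enorm_ge0 (x - x)))// enorm_le_diameter.
Qed.

End Topology.

(** * The maximum function [psi]: convexity and subgradients *)

Section Psi.
Context {R : realType} {n : nat}.
Variables (f h : 'rV[R]_n -> R).
Implicit Types (x y s : 'rV[R]_n) (a t : R).

Lemma psi_convex t x y a :
  convex_function setT f -> convex_function setT h -> 0 <= a <= 1 ->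
  psi f h t ((1 - a) *: x + a *: y) <= (1 - a) * psi f h t x + a * psi f h t y.
Proof.
move=> cf ch a01; have /andP[a0 a1] := a01.
have b0 : 0 <= 1 - a by rewrite subr_ge0.
have fx : f x - t <= psi f h t x by rewrite /psi le_max lexx.
have fy : f y - t <= psi f h t y by rewrite /psi le_max lexx.
have hx : h x <= psi f h t x by rewrite /psi le_max lexx orbT.
have hy : h y <= psi f h t y by rewrite /psi le_max lexx orbT.
rewrite [leLHS]/psi ge_max; apply/andP; split.
  have := convex_fctP x y cf a01.
  have := ler_wpM2l b0 fx; have := ler_wpM2l a0 fy; lra.
have := convex_fctP x y ch a01.
have := ler_wpM2l b0 hx; have := ler_wpM2l a0 hy; lra.
Qed.

(** The affine minorant of an active function stays below [psi], which dominates both [f - t] and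
    [h]; at a tie both are active, and convex combinations inherit the property. *)
Lemma psi_subgradientP Cf Ch t x s : psi_subgradient f h Cf Ch t x s ->
  subgradient (psi f h t) x s /\ enorm s <= Num.max Cf Ch.
Proof.
have fp y : f y - t <= psi f h t y by rewrite /psi le_max lexx.
have hp y : h y <= psi f h t y by rewrite /psi le_max lexx orbT.
case=> [[hf [sf sC]]|[fh [sh sC]]|].
- split; last by rewrite le_max sC.
  move=> y; rewrite {1}/psi (max_l (ltW hf)); have := fp y; have := sf y; lra.
- split; last by rewrite le_max sC orbT.
  move=> y; rewrite {1}/psi (max_r (ltW fh)); have := hp y; have := sh y; lra.
move=> [fh [a [s1 [s2 [a01 [sf s1C] [sh s2C] ->]]]]].
have /andP[a0 a1] := a01; have b0 : 0 <= 1 - a by rewrite subr_ge0.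
split=> [y|].
  rewrite {1}/psi fh maxxx dotpDl !dotpZl.
  have := ler_wpM2l a0 (le_trans (lerB (sf y) (lexx t)) (fp y)).
  have := ler_wpM2l b0 (le_trans (sh y) (hp y)).
  by have := congr1 ( *%R a) fh; lra.
have s1m : enorm s1 <= Num.max Cf Ch by rewrite le_max s1C.
have s2m : enorm s2 <= Num.max Cf Ch by rewrite le_max s2C orbT.
rewrite (le_trans (enormD _ _))// !enormZ !ger0_norm//.
move: (Num.max Cf Ch) s1m s2m => m s1m s2m.
have := ler_wpM2l a0 s1m; have := ler_wpM2l b0 s2m; lra.
Qed.

End Psi.

(** * Averages of iterates and Jensen's inequality *)

Section Average.
Context {R : realType} {n : nat}.
Implicit Types (x : nat -> 'rV[R]_n) (K : nat).

Definition average x K := K%:R^-1 *: \sum_(0 <= k < K) x k.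

Lemma average1 x : average x 1 = x 0%N.
Proof. by rewrite /average big_nat1 invr1 scale1r. Qed.

(** Exhibits the average as a two-point convex combination, so that two-point convexity suffices in
    the inductions below. *)
Lemma averageS x K : average x K.+2 =
  (1 - K.+2%:R^-1) *: average x K.+1 + K.+2%:R^-1 *: x K.+1.
Proof.
rewrite /average big_nat_recr//= scalerDr; congr (_ + _).
rewrite scalerA; congr (_ *: _).
have : K.+2%:R = K.+1%:R + 1 :> R by rewrite natr1.
have : K.+2%:R != 0 :> R by rewrite pnatr_eq0.
have : K.+1%:R != 0 :> R by rewrite pnatr_eq0.
move: (K.+1%:R : R) (K.+2%:R : R) => b c b0 c0 cE.
by rewrite cE in c0 *; field; rewrite c0 b0.
Qed.

Lemma inv_nat01 K : 0 <= (K.+1%:R^-1 : R) <= 1.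
Proof. by rewrite invr_ge0 ler0n invf_le1 ?ltr0n// ler1n. Qed.

Lemma convex_set_average (Z : set 'rV[R]_n) x K : convex_set Z ->
  (forall k, (k <= K)%N -> Z (x k)) -> Z (average x K.+1).
Proof.
move=> cZ; elim: K => [Zx|K IH Zx]; first by rewrite average1; exact: Zx.
rewrite averageS; apply: convex_setP; rewrite ?inv_nat01//.
  by apply: IH => k kK; apply: Zx; rewrite (leq_trans kK).
exact: Zx.
Qed.

Lemma jensen_average (phi : 'rV[R]_n -> R) x K :
  (forall y z a, 0 <= a <= 1 ->
     phi ((1 - a) *: y + a *: z) <= (1 - a) * phi y + a * phi z) ->
  K.+1%:R * phi (average x K.+1) <= \sum_(0 <= k < K.+1) phi (x k).
Proof.
move=> cphi; elim: K => [|K IH]; first by rewrite average1 big_nat1 mul1r.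
rewrite big_nat_recr//= averageS.
rewrite (le_trans (ler_wpM2l _ (cphi _ _ _ (inv_nat01 _))))//.
have -> : K.+2%:R * ((1 - K.+2%:R^-1) * phi (average x K.+1) +
    K.+2%:R^-1 * phi (x K.+1)) =
  K.+1%:R * phi (average x K.+1) + phi (x K.+1).
  have : K.+2%:R = K.+1%:R + 1 :> R by rewrite natr1.
  have : K.+2%:R != 0 :> R by rewrite pnatr_eq0.
  move: (K.+1%:R : R) (K.+2%:R : R) => b c c0 cE.
  by rewrite cE in c0 *; field.
by rewrite lerD2r.
Qed.

End Average.

(** * The projected subgradient method *)

Section Subgradient_method.
Context {R : realType} {n : nat}.
Variables (f h : 'rV[R]_n -> R) (Z : set 'rV[R]_n).
Hypotheses (cvxZ : convex_set Z) (cmpZ : compact Z).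
Implicit Types (x s : nat -> 'rV[R]_n) (K : nat).

(** Sums [|x_(k+1) - z|^2 <= |x_k - z|^2 - 2 eta <s_k, x_k - z> + eta^2 C^2], which holds because
    projecting onto [Z] brings the point no farther from [z]. *)
Lemma projected_step_telescope x s (eta C : R) K z :
  (forall k, (k < K)%N -> enorm (s k) <= C) ->
  (forall k, (k < K)%N -> is_proj Z (x k - eta *: s k) (x k.+1)) -> Z z ->
  2 * eta * \sum_(0 <= k < K) dotp (s k) (x k - z) <=
  enorm (x 0%N - z) ^+ 2 - enorm (x K - z) ^+ 2 + K%:R * (eta * C) ^+ 2.
Proof.
elim: K => [|K IH] sC px Zz; first by rewrite big_geq//; lra.
have := IH (fun k kK => sC k (ltnW kK)) (fun k kK => px k (ltnW kK)) Zz.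
rewrite big_nat_recr//= -[K.+1]addn1 natrD addn1.
have p0 := is_proj_dotp_le0 cvxZ (px K (leqnn _)) Zz.
(* Expanded around [x_(k+1)], the cross term has the right sign by [p0] and the remaining square is
   dropped. *)
have step : enorm (x K.+1 - z) ^+ 2 <= enorm (x K - eta *: s K - z) ^+ 2.
  have -> : x K - eta *: s K - z =
      (x K - eta *: s K - x K.+1) - (z - x K.+1) by rewrite opprB addrA subrK.
  rewrite -enormN opprB !enorm_sqr [leRHS]dotpBB.
  have := dotp_ge0 (x K - eta *: s K - x K.+1); lra.
have eq1 : x K - eta *: s K - z = (x K - z) - eta *: s K by rewrite addrAC.
have sC2 : enorm (s K) ^+ 2 <= C ^+ 2.
  rewrite lerXn2r// ?nnegrE ?enorm_ge0//; last exact: sC.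
  by rewrite (le_trans (enorm_ge0 _) (sC K _)).
have sC3 := ler_wpM2l (sqr_ge0 eta) sC2.
move: step; rewrite eq1 !enorm_sqr (dotpBB (x K - z)) !(dotpZl, dotpZr).
rewrite -!enorm_sqr (dotpC (s K)); lra.
Qed.

(** The step size satisfies [eta C sqrt K = D]: the telescoped right-hand side is at most
    [D^2 + D^2], and [2 D^2 = 2 eta D C sqrt K]. *)
Lemma projected_step_sum x s (C : R) K z (D := diameter Z) :
  (forall k, (k < K)%N -> enorm (s k) <= C) ->
  (forall k, (k < K)%N ->
    is_proj Z (x k - (D / (C * Num.sqrt K%:R)) *: s k) (x k.+1)) ->
  (forall k, (k <= K)%N -> Z (x k)) -> Z z ->
  \sum_(0 <= k < K) dotp (s k) (x k - z) <= D * C * Num.sqrt K%:R.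
Proof.
move=> sC px Zx Zz.
case: K sC px Zx => [|K] sC px Zx; first by rewrite big_geq// sqrtr0 mulr0.
have D0 : 0 <= D by exact: diameter_ge0 cmpZ Zz.
have C0 : 0 <= C := le_trans (enorm_ge0 _) (sC 0%N isT).
set q := Num.sqrt K.+1%:R; have q0 : 0 < q by rewrite sqrtr_gt0 ltr0n.
have q2 : q ^+ 2 = K.+1%:R by rewrite sqr_sqrtr ?ler0n.
have dZ k : (k <= K.+1)%N -> enorm (x k - z) <= D.
  by move=> kK; apply: enorm_le_diameter => //; exact: Zx.
(* If [D C = 0] the step size is 0 (division by 0 gives 0) and telescoping says nothing;
   Cauchy-Schwarz bounds each term by [D C]. *)
have [DC|DC] := eqVneq (D * C) 0.
  rewrite DC mul0r big_nat; apply: sumr_le0 => k /andP[_ kK].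
  rewrite (le_trans (dotp_le _ _))// -DC mulrC.
  by rewrite ler_pM ?enorm_ge0 ?dZ ?sC// ltnW.
have {}D0 : 0 < D.
  rewrite lt_neqAle D0 andbT eq_sym.
  by apply: contraNneq DC => ->; rewrite mul0r.
have {}C0 : 0 < C.
  rewrite lt_neqAle C0 andbT eq_sym.
  by apply: contraNneq DC => ->; rewrite mulr0.
set eta := D / (C * q) in px.
have eta0 : 0 < eta by rewrite divr_gt0// mulr_gt0.
have etaD : eta * C * q = D.
  by rewrite /eta; field; rewrite !lt0r_neq0.
have := projected_step_telescope sC px Zz; set S := \sum_(_ <= _ < _) _.
have : enorm (x 0%N - z) ^+ 2 <= D ^+ 2.
  by rewrite lerXn2r// ?nnegrE ?enorm_ge0 ?(ltW D0)// dZ.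
have := sqr_ge0 (enorm (x K.+1 - z)).
rewrite -q2 -exprMn (mulrC q) etaD => H1 H2 H3.
rewrite -(ler_pM2l eta0).
have -> : eta * (D * C * q) = D * (eta * C * q) by ring.
rewrite etaD -expr2.
lra.
Qed.

(** The subgradient inequality bounds each gap by [<s_k, x_k - z>], and Jensen passes to the
    averaged output. *)
Lemma lip_subroutine_gap Cf Ch t K (x0 out : 'rV[R]_n) :
  convex_function setT f -> convex_function setT h -> (0 < K)%N -> Z x0 ->
  lip_subroutine f h Z (diameter Z) Cf Ch K t x0 out ->
  Z out /\ forall z, Z z ->
    K%:R * (psi f h t out - psi f h t z) <=
    diameter Z * Num.max Cf Ch * Num.sqrt K%:R.
Proof.
move=> cf ch K0 Zx0 [x [s [x0E step ->]]].
have sg k : (k < K)%N -> _ := fun kK => psi_subgradientP (step k kK).1.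
have Zx k : (k <= K)%N -> Z (x k).
  by case: k => [|k kK]; [rewrite x0E|exact: (step k kK).2.1].
case: K K0 step sg Zx => // K _ step sg Zx; split.
  by apply: convex_set_average => // k kK; apply: Zx; rewrite ltnW.
move=> z Zz.
have := @projected_step_sum x s _ K.+1 z (fun k kK => (sg k kK).2)
  (fun k kK => (step k kK).2) Zx Zz.
apply: le_trans; rewrite mulrBr lerBlDr.
apply: le_trans (jensen_average _ _ _) _.
  by move=> y w a; exact: psi_convex.
have -> : K.+1%:R * psi f h t z = \sum_(0 <= k < K.+1) psi f h t z.
  by rewrite sumr_const_nat subn0 mulr_natl.
rewrite -big_split/= !big_nat; apply: ler_sum => k /andP[_ kK].
have := (sg k kK).1 z; rewrite -opprB dotpNr; lra.
Qed.

(** A subgradient and the resulting projection are chosen as a function [F] of the current point,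
    which is then iterated; outside [Z], which the iterates never leave, its value is arbitrary. *)
Lemma lip_subroutine_exists D Cf Ch t K (x0 : 'rV[R]_n) : Z x0 ->
  (forall x : 'rV[R]_n, Z x ->
     exists s : 'rV[R]_n, bounded_subgradient Cf f x s) ->
  (forall x : 'rV[R]_n, Z x ->
     exists s : 'rV[R]_n, bounded_subgradient Ch h x s) ->
  exists out, lip_subroutine f h Z D Cf Ch K t x0 out.
Proof.
move=> Zx0 sf sh; set eta := D / (Num.max Cf Ch * Num.sqrt K%:R).
have /choice[F FP] : forall x : 'rV[R]_n,
  exists sp : 'rV[R]_n * 'rV[R]_n, Z x ->
    psi_subgradient f h Cf Ch t x sp.1 /\ is_proj Z (x - eta *: sp.1) sp.2.
  move=> x; have [Zx|nZx] := pselect (Z x); last by exists (0, 0).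
  have [s Hs] : exists s : 'rV[R]_n, psi_subgradient f h Cf Ch t x s.
    have [s1 H1] := sf x Zx; have [s2 H2] := sh x Zx.
    case: (ltgtP (f x - t) (h x)) => E.
    - by exists s2; apply: Or32.
    - by exists s1; apply: Or31.
    - exists (1 *: s1 + (1 - 1) *: s2); apply: Or33; split=> //.
      by exists 1, s1, s2; split=> //; rewrite ler01 lexx.
  have [p Hp] := is_proj_exists (x - eta *: s) (ex_intro _ x0 Zx0) cmpZ.
  by exists (s, p).
pose x k := iter k (fun y => (F y).2) x0.
have Zx k : Z (x k) by elim: k => //= k IH; exact: (FP _ IH).2.1.
exists (K%:R^-1 *: \sum_(0 <= k < K) x k), x, (fun k => (F (x k)).1).
by split=> // k _; exact: FP.
Qed.

End Subgradient_method.

(** * Bisection on the level [t] *)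

Section Bisection.
Context {R : realType} {n : nat}.
Variables (f h : 'rV[R]_n -> R) (Z : set 'rV[R]_n) (eps : R).
Variable sub : R -> 'rV[R]_n -> 'rV[R]_n -> Prop.

Lemma bisection_exists N l u xbar xu : Z xbar ->
  (forall t x, Z x -> exists y, sub t x y) ->
  (forall t x y, Z x -> sub t x y -> Z y) ->
  exists out, bisection f h eps sub N l u xbar xu out.
Proof.
move=> Zx tot stab; elim: N l u xbar xu Zx => [|N IH] l u xbar xu Zx.
  by exists xu; exact: bisection_done.
have [y Hy] := tot ((l + u) / 2) xbar Zx; have Zy := stab _ _ _ Zx Hy.
case: (leP (psi f h ((l + u) / 2) y) (eps / 2)) => E.
  have [out Hout] := IH l ((l + u) / 2) y y Zy.
  by exists out; exact: bisection_upper Hout.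
have [out Hout] := IH ((l + u) / 2) u y xu Zy.
by exists out; exact: bisection_lower Hout.
Qed.

(** When no repetition is left, [psi u xu <= eps / 2] bounds [f xu - u] and [h xu], while
    [l <= f xF] gives [u <= f xF + (u - l)]; each repetition halves [u - l]. *)
Lemma bisection_correct xF N l u xbar xu out :
  Z xF -> h xF <= 0 ->
  (forall t x y, Z x -> sub t x y ->
     Z y /\ psi f h t y <= psi f h t xF + eps / 2) ->
  bisection f h eps sub N l u xbar xu out ->
  Z xbar -> l <= f xF -> psi f h u xu <= eps / 2 ->
  f out <= f xF + (u - l) / 2 ^+ N + eps / 2 /\ h out <= eps / 2.
Proof.
move=> ZF hF subP; elim=> {N l u xbar xu out}
  [l u xbar xu|N l u xbar xu xt out st lt _ IH|N l u xbar xu xt out st lt _ IH]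
  Zx lF; rewrite /psi.
- rewrite ge_max => /andP[fu hu]; split=> //; rewrite expr0 divr1; lra.
- move=> pu; have [Zt tF] := subP _ _ _ Zx st.
  have {}IH := IH Zt _ pu.
  have -> : (u - l) / 2 ^+ N.+1 = (u - (l + u) / 2) / 2 ^+ N.
    by rewrite exprS; field; rewrite expf_neq0.
  (* If [f xF < t], then [psi t xF <= 0], and the accuracy of the subroutine forces
     [psi t xt <= eps / 2], against the test. *)
  apply: IH; rewrite leNgt; apply/negP => Ft.
  have : psi f h ((l + u) / 2) xF <= 0.
    by rewrite /psi ge_max hF andbT; lra.
  lra.
(* The test just passed is itself the invariant for the new upper bound and its point. *)
- move=> _; have [Zt _] := subP _ _ _ Zx st.
  have -> : (u - l) / 2 ^+ N.+1 = ((l + u) / 2 - l) / 2 ^+ N.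
    by rewrite exprS; field; rewrite expf_neq0.
  exact: IH.
Qed.

End Bisection.

(** * Number of bisection rounds *)

Section Counting.
Context {R : realType}.
Implicit Types (l u eps X : R).

(** From [exp (-1/2) >= 1/2]; this lets binary logarithms become natural ones at the cost of a
    factor 2. *)
Lemma ln2_ge_half : 1 / 2 <= ln 2 :> R.
Proof.
rewrite -ler_expR lnK ?posrE//.
have := expR_ge1Dx (- (1 / 2) : R); rewrite expRN.
have := expR_gt0 (1 / 2 : R); set e := expR _ => e0.
rewrite -(ler_pM2r e0) mulVf ?lt0r_neq0//; lra.
Qed.

(** The ceiling is below [log2 (2 rho) + 1 = log2 rho + 2], and [log2 rho <= 2 ln (1 + rho)]. *)
Lemma bisection_count_le l u eps : 0 < eps -> l <= u ->
  (bisection_count l u eps)%:R <= 2 * (1 + ln (1 + (u - l) / eps)).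
Proof.
move=> e0 lu; set rho := (u - l) / eps.
have rho0 : 0 <= rho by rewrite divr_ge0 ?subr_ge0// ltW.
have L0 : 0 <= ln (1 + rho) by rewrite ln_ge0// lerDl.
rewrite /bisection_count; set m := Num.ceil _.
have [_|m0] := leP m 0; first by rewrite /=; lra.
rewrite natr_absz ger0_norm ?ltW//.
have l2 := ln2_ge_half; have l20 : 0 < ln 2 :> R by lra.
have := ceilB1_lt (ln ((u - l) / (eps / 2)) / ln 2); rewrite -/m intrB.
have -> : (u - l) / (eps / 2) = 2 * rho :> R.
  by rewrite /rho; field; exact: lt0r_neq0.
have y0 : 0 < ln ((u - l) / (eps / 2)) / ln 2 by rewrite -ceil_gt0.
(* For [rho = 0] the convention [ln 0 = 0] would contradict the positive ceiling. *)
have {}rho0 : 0 < rho.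
  rewrite lt_neqAle rho0 andbT; apply: contraTneq y0 => r0.
  by rewrite invfM mulrA -/rho -r0 mul0r ln0// mul0r ltxx.
rewrite lnM ?posrE// mulrDl divff ?lt0r_neq0//.
have : ln rho / ln 2 <= 2 * ln (1 + rho).
  rewrite ler_pdivrMr//.
  have lr : ln rho <= ln (1 + rho) by rewrite ler_ln ?posrE ?addr_gt0// lerDr.
  have := ler_wpM2l L0 l2; lra.
lra.
Qed.

Lemma bisection_count_ge l u eps : 0 < eps -> l <= u ->
  (u - l) / 2 ^+ bisection_count l u eps <= eps / 2.
Proof.
move=> e0 lu; have [->|ul] := eqVneq u l.
  by rewrite subrr mul0r divr_ge0// ltW.
have d0 : 0 < u - l by rewrite subr_gt0 lt_neqAle eq_sym ul.
have q0 : 0 < (u - l) / (eps / 2) by rewrite !divr_gt0.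
rewrite ler_pdivrMr ?exprn_gt0// mulrC -ler_pdivrMr ?divr_gt0//.
rewrite -ler_ln ?posrE ?exprn_gt0// lnXn// -[ln 2 *+ _]mulr_natl.
have l2 : 0 < ln 2 :> R by have := ln2_ge_half; lra.
rewrite -ler_pdivrMr// /bisection_count natr_absz ger0_norm ?le_max ?lexx//.
by rewrite (le_trans (ceil_ge _))// ler_int le_max lexx orbT.
Qed.

End Counting.

(** * Smooth functions: descent lemma and quadratic models *)

Section Smooth.
Context {R : realType} {n : nat}.
Implicit Types (f g : 'rV[R]_n -> R) (x y z d p w : 'rV[R]_n) (a b c t L : R).

Lemma derive_dotp_grad f x d : differentiable (f : 'rV[R]_n -> R^o) x ->
  'D_d (f : 'rV[R]_n -> R^o) x = dotp (grad f x) d.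
Proof.
move=> df; rewrite deriveE// {1}(row_sum_delta d) linear_sum.
by apply: eq_bigr => i _; rewrite linearZ mxE deriveE// mulrC.
Qed.

(** The difference quotient of the restriction to the line is literally that of the derivative in
    direction [d] at [y + t d]. *)
Lemma is_derive_line f y d t :
  differentiable (f : 'rV[R]_n -> R^o) (y + t *: d) ->
  is_derive t (1 : R) (fun t => f (y + t *: d) : R^o)
    (dotp (grad f (y + t *: d)) d).
Proof.
move=> df; rewrite -derive_dotp_grad//.
have E : (fun a : R => a^-1 *: ((f (y + (a *: (1 : R) + t) *: d) : R^o)
     - f (y + t *: d))) =
   (fun a : R => a^-1 *: ((f (a *: d + (y + t *: d)) : R^o) - f (y + t *: d))).
  apply/funext => a; congr (_ *: (f _ - _)).
  by rewrite [_ *: (1 : R)]mulr1 scalerDl addrCA.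
split; last by rewrite /derive E.
by rewrite /derivable E; exact: diff_derivable.
Qed.

Lemma grad_affine c b f x : differentiable (f : 'rV[R]_n -> R^o) x ->
  grad (fun x => c * (f x - b)) x = c *: grad f x.
Proof.
move=> df; apply/rowP => i; rewrite !mxE.
have dfi : derivable (f : 'rV[R]_n -> R^o) x (delta_mx ord0 i).
  exact: diff_derivable.
rewrite [LHS](@deriveZ _ _ _ ((f : 'rV[R]_n -> R^o) - cst b)).
  by rewrite deriveB// derive_cst subr0.
exact: derivableB.
Qed.

Lemma smooth_affine c b L f :
  smooth L f -> smooth (`|c| * L) (fun x => c * (f x - b)).
Proof.
move=> [df Lf]; split=> [x|x y].
  apply: (@differentiableZ _ _ _ ((f : 'rV[R]_n -> R^o) - cst b) c).
  exact: differentiableB.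
by rewrite !grad_affine// -scalerBr enormZ -mulrA ler_wpM2l.
Qed.

Lemma convex_affine c b f : 0 <= c -> convex_function setT f ->
  convex_function setT (fun x => c * (f x - b)).
Proof.
move=> c0 cf t x y xT yT; have := cf t x y xT yT.
rewrite !convRE /unstable.onem => H.
have := ler_wpM2l c0 H; move: {H}(f (conv t x y)) (t%:num) => u s /=.
lra.
Qed.

(** [f (y + t d)] minus the quadratic bound [p] has derivative [<grad f (y + t d) - grad f y, d> - L
    t |d|^2], nonpositive on [[0, 1]] by Cauchy-Schwarz and the Lipschitz gradient. *)
Lemma descent L f y d : smooth L f ->
  f (y + d) <= f y + dotp (grad f y) d + L / 2 * dotp d d.
Proof.
move=> [df Lf].
pose p := dotp (grad f y) d *: 'X + (L / 2 * dotp d d) *: 'X^2 : {poly R}.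
have pE t : p.[t] = dotp (grad f y) d * t + L / 2 * dotp d d * t ^+ 2.
  by rewrite hornerD !hornerZ hornerX hornerXn.
have dp t : p^`().[t] = dotp (grad f y) d + L * dotp d d * t.
  rewrite derivD !derivZ derivX derivXn !hornerE /=; lra.
pose phi := (fun t => f (y + t *: d) : R^o) - (horner p : R -> R^o).
have dphi t : is_derive t (1 : R) phi
    (dotp (grad f (y + t *: d)) d - p^`().[t]).
  by apply: is_deriveB; exact: is_derive_line.
have : phi 1 <= phi 0.
  apply: (@ler0_derive1_nincr _ phi 0 1) => // [t|].
  - rewrite in_itv/= => /andP[t0 _]; rewrite derive1E derive_val.
    rewrite dp.
    have := le_trans (dotp_le (grad f (y + t *: d) - grad f y) d)
      (ler_wpM2r (enorm_ge0 d) (Lf _ _)).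
    rewrite addrAC subrr add0r enormZ gtr0_norm// dotpDl dotpNl.
    rewrite -enorm_sqr; lra.
  - apply: derivable_within_continuous => t _; exact: ex_derive.
rewrite /phi !fctE !pE scale1r scale0r addr0; lra.
Qed.

Lemma descent_lower L f y d : smooth L f ->
  f y + dotp (grad f y) d - L / 2 * dotp d d <= f (y + d).
Proof.
move=> sf; have [df _] := sf.
have := descent y d (smooth_affine (-1) 0 sf).
rewrite grad_affine// dotpZl normrN1; lra.
Qed.

(** Convexity bounds [f (y + a d)] above and smoothness bounds it below up to [O(a^2)]; dividing by
    [a] and letting [a -> 0] leaves the tangent inequality. *)
Lemma convex_grad_le L f y d : convex_function setT f -> smooth L f ->
  f y + dotp (grad f y) d <= f (y + d).
Proof.
move=> cf sf; rewrite -subr_le0.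
apply: (@le0_of_le_small _ _ (L / 2 * dotp d d)) => a /andP[a0 a1].
have := convex_fctP y (y + d) cf (_ : 0 <= a <= 1); rewrite ltW// => /(_ a1).
have -> : (1 - a) *: y + a *: (y + d) = y + a *: d.
  by apply/rowP => i; rewrite !mxE; ring.
have := descent_lower y (a *: d) sf; rewrite !(dotpZl, dotpZr).
by move=> lower conv; rewrite -(ler_pM2l a0); lra.
Qed.

Lemma quad_model_ge L L' f y x : smooth L' f -> L' <= L ->
  f x <= quad_model L f y x.
Proof.
move=> sf LL; have := descent y (x - y) sf; rewrite [y + _]addrC subrK.
rewrite /quad_model enorm_sqr; have := ler_wpM2r (dotp_ge0 (x - y)) LL; lra.
Qed.

Lemma quad_model_le L L' f y x : convex_function setT f -> smooth L' f ->
  quad_model L f y x <= f x + L / 2 * enorm (x - y) ^+ 2.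
Proof.
move=> cf sf; have := convex_grad_le y (x - y) cf sf.
by rewrite [y + _]addrC subrK /quad_model lerD2r.
Qed.

(** An exact identity whose last term is the same for [f] and [h], so that this strong convexity
    survives the maximum in [psi_model]. *)
Lemma quad_model_combine L f y p z a :
  quad_model L f y ((1 - a) *: p + a *: z) =
  (1 - a) * quad_model L f y p + a * quad_model L f y z
  - L / 2 * (a * (1 - a)) * enorm (z - p) ^+ 2.
Proof.
rewrite /quad_model !enorm_sqr.
have -> : (1 - a) *: p + a *: z - y = (1 - a) *: (p - y) + a *: (z - y).
  by apply/rowP => i; rewrite !mxE; ring.
have -> : z - p = (z - y) - (p - y) by rewrite opprB subrKA.
move: (p - y) (z - y) => u v; rewrite dotpBB !dotpE (dotpC v u); ring.
Qed.

End Smooth.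

(** * The accelerated method for the maximum of two smooth functions *)

Section Accelerated_method.
Context {R : realType} {n : nat}.
Variables (f h : 'rV[R]_n -> R) (Z : set 'rV[R]_n) (Lf Lh : R).
Hypotheses (cvxZ : convex_set Z) (cmpZ : compact Z).
Hypotheses (cvxf : convex_function setT f) (cvxh : convex_function setT h).
Hypotheses (smf : smooth Lf f) (smh : smooth Lh h) (Lf0 : 0 <= Lf).
Local Notation L := (Num.max Lf Lh).

Let L0 : 0 <= L. Proof. by rewrite le_max Lf0. Qed.

Lemma psi_model_ge t y x : psi f h t x <= psi_model f h L t y x.
Proof.
rewrite /psi /psi_model ge_max !le_max; apply/andP; split.
  by rewrite lerD2r (quad_model_ge _ _ smf)// le_max lexx.
by rewrite (quad_model_ge _ _ smh) ?orbT// le_max lexx orbT.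
Qed.

Lemma psi_model_le t y x :
  psi_model f h L t y x <= psi f h t x + L / 2 * enorm (x - y) ^+ 2.
Proof.
rewrite [leLHS]/psi_model ge_max; apply/andP; split.
  have : f x - t <= psi f h t x by rewrite le_max lexx.
  have := quad_model_le L y x cvxf smf; lra.
have : h x <= psi f h t x by rewrite le_max lexx orbT.
have := quad_model_le L y x cvxh smh; lra.
Qed.

Lemma psi_model_strongly_convex t y p z a : 0 <= a <= 1 ->
  psi_model f h L t y ((1 - a) *: p + a *: z) <=
  (1 - a) * psi_model f h L t y p + a * psi_model f h L t y z
  - L / 2 * (a * (1 - a)) * enorm (z - p) ^+ 2.
Proof.
move=> /andP[a0 a1]; have b0 : 0 <= 1 - a by rewrite subr_ge0.
rewrite [leLHS]/psi_model !quad_model_combine ge_max; apply/andP; split.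
  have := ler_wpM2l b0 (_ : quad_model L f y p - t <= psi_model f h L t y p).
  rewrite {1}/psi_model le_max lexx => /(_ isT).
  have := ler_wpM2l a0 (_ : quad_model L f y z - t <= psi_model f h L t y z).
  rewrite {1}/psi_model le_max lexx => /(_ isT); lra.
have := ler_wpM2l b0 (_ : quad_model L h y p <= psi_model f h L t y p).
rewrite {1}/psi_model le_max lexx orbT => /(_ isT).
have := ler_wpM2l a0 (_ : quad_model L h y z <= psi_model f h L t y z).
rewrite {1}/psi_model le_max lexx orbT => /(_ isT); lra.
Qed.

(** Quadratic growth at a constrained minimizer: [p] is compared with [(1 - a) p + a w] by strong
    convexity, then [a -> 0]. *)
Lemma argmin_psi_model t y p w : argmin_set Z (psi_model f h L t y) p -> Z w ->
  psi_model f h L t y p + L / 2 * enorm (w - p) ^+ 2 <= psi_model f h L t y w.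
Proof.
move=> [Zp pmin] Zw; rewrite -subr_le0.
apply: (@le0_of_le_small _ _ (L / 2 * enorm (w - p) ^+ 2)) => a /andP[a0 a1].
have a01 : 0 <= a <= 1 by rewrite ltW.
have := pmin _ (convex_setP cvxZ Zp Zw a01).
have := psi_model_strongly_convex t y p w a01.
by move=> convex min_p; rewrite -(ler_pM2l a0); lra.
Qed.

(** Quadratic growth of the model, which lies above [psi] at [p] and at most [L / 2 |w - y|^2] above
    it at [w]. *)
Lemma prox_step t y p w : argmin_set Z (psi_model f h L t y) p -> Z w ->
  psi f h t p + L / 2 * enorm (w - p) ^+ 2 <=
  psi f h t w + L / 2 * enorm (w - y) ^+ 2.
Proof.
move=> pm Zw; have := argmin_psi_model pm Zw.
have := psi_model_ge t y p; have := psi_model_le t y w; lra.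
Qed.

(** The purpose of the extrapolation coefficient: it makes [w_(k+1) - y_(k+1)] equal to
    [(a' / a) (w_k - x_(k+1))], and [(a' / a)^2 = 1 - a']. *)
Lemma momentum_step (x x' y' z : 'rV[R]_n) (a a' : R) :
  0 < a -> 0 < a' < 1 -> a' ^+ 2 = (1 - a') * a ^+ 2 ->
  y' = x' + (a * (1 - a) / (a ^+ 2 + a')) *: (x' - x) ->
  enorm ((1 - a') *: x' + a' *: z - y') ^+ 2 =
  (1 - a') * enorm ((1 - a) *: x + a *: z - x') ^+ 2.
Proof.
move=> a0 /andP[a'0 a'1] aE ->.
have b0 : a ^+ 2 + a' != 0 by rewrite lt0r_neq0// addr_gt0// exprn_gt0.
(* The recurrence reads [a^2 = a' (a^2 + a')], which removes the denominator [a^2 + a']. *)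
have betaE : a * (1 - a) / (a ^+ 2 + a') = a' * (1 - a) / a.
  have aE' : a ^+ 2 = a' * (a ^+ 2 + a') by rewrite mulrDr -expr2 aE; ring.
  apply: (mulIf b0); rewrite divfK// -[LHS]mul1r -(divff (lt0r_neq0 a0)).
  transitivity ((1 - a) * a ^+ 2 / a); first by field; exact: lt0r_neq0.
  by rewrite {1}aE'; field; exact: lt0r_neq0.
rewrite betaE.
have -> : (1 - a') *: x' + a' *: z - (x' + (a' * (1 - a) / a) *: (x' - x)) =
    (a' / a) *: ((1 - a) *: x + a *: z - x').
  by apply/rowP => i; rewrite !mxE; field; exact: lt0r_neq0.
rewrite enormZ exprMn -normrX ger0_norm ?sqr_ge0// expr_div_n aE.
by field; exact: lt0r_neq0.
Qed.

(** If [a' (m + 5) > 2], then [a' (m + 4) > 2 - a']; squaring and using the recurrence gives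
    [(2 - a')^2 < 4 (1 - a')], which is absurd. *)
Lemma momentum_le (alpha : nat -> R) K : alpha 0%N = 1 / 2 ->
  (forall k, (k < K)%N -> 0 < alpha k.+1 < 1 /\
     alpha k.+1 ^+ 2 = (1 - alpha k.+1) * alpha k ^+ 2) ->
  forall k, (k <= K)%N -> 0 < alpha k /\ alpha k * (4 + k%:R) <= 2.
Proof.
move=> al0 alS; elim=> [_|k IH kK]; first by rewrite al0; split; lra.
have [/andP[a'0 a'1] aE] := alS k kK; have [a0 ak] := IH (ltnW kK).
split=> //; rewrite -[k.+1%:R]natr1; have k0 : 0 <= k%:R :> R by [].
move: (alpha k.+1) (alpha k) (k%:R : R) a'0 a'1 aE a0 ak k0 => a' a m.
move=> a'0 a'1 aE a0 am m0.
rewrite leNgt; apply/negP => gt2.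
have s0 : 0 < 2 - a' by lra.
have : (2 - a') ^+ 2 < (a' * (4 + m)) ^+ 2.
  have p0 : 0 <= a' * (4 + m) by rewrite mulr_ge0 ?(ltW a'0)// addr_ge0.
  rewrite ltr_pXn2r// ?nnegrE ?(ltW s0)//; lra.
have : (a * (4 + m)) ^+ 2 <= 2 ^+ 2.
  by rewrite lerXn2r// ?nnegrE// mulr_ge0 ?(ltW a0)// addr_ge0.
rewrite exprMn [(a' * _) ^+ 2]exprMn aE => H1.
have b0 : 0 <= 1 - a' by lra.
have := ler_wpM2l b0 H1; have := sqr_ge0 a'; nra.
Qed.

Lemma sm_subroutine_gap t K x0 out : (0 < K)%N -> Z x0 ->
  sm_subroutine f h Z Lf Lh K t x0 out ->
  Z out /\ forall z, Z z -> K%:R ^+ 2 * (psi f h t out - psi f h t z) <=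
    16 * L * diameter Z ^+ 2.
Proof.
case: K => // K _ Zx0 [x [y [alpha [[x0E y0E] al0 step ->]]]].
split; first by have [[]] := step K (leqnn _).
move=> z Zz; set D := diameter Z.
have D0 : 0 <= D by exact: diameter_ge0 cmpZ Zz.
have mom := momentum_le al0 (fun k kK =>
  let: And4 _ a1 a2 _ := step k kK in conj a1 a2).
have Zx k : (k <= K.+1)%N -> Z (x k).
  by case: k => [|k kK]; [rewrite x0E|have [[]] := step k kK].
have dD u v : Z u -> Z v -> enorm (u - v) ^+ 2 <= D ^+ 2.
  by move=> Zu Zv; rewrite lerXn2r ?nnegrE ?enorm_ge0// enorm_le_diameter.
pose w k := (1 - alpha k) *: x k + alpha k *: z.
have a01 k : (k <= K)%N -> 0 <= alpha k <= 1.
  case: k => [_|k kK]; first by rewrite al0; lra.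
  by have [_ /andP[a0 a1] _ _] := step k (ltnW kK); rewrite !ltW.
have Zw k : (k <= K)%N -> Z (w k).
  by move=> kK; apply: convex_setP => //; [apply: Zx; rewrite ltnW|exact: a01].
(* The factor 4 comes from [alpha_0^2 = 1/4]: at [k = 0] the gap and the distance term are each at
   most [L D^2 / 2]. *)
have pot k : (k <= K)%N -> psi f h t (x k.+1) - psi f h t z +
    L / 2 * enorm (w k - x k.+1) ^+ 2 <= 4 * L * D ^+ 2 * alpha k ^+ 2.
  elim: k => [_|k IH kK].
    have [am _ _ _] := step 0%N isT; have := prox_step am Zz; rewrite y0E al0.
    have Lp : 0 <= L / 2 by rewrite divr_ge0.
    have := ler_wpM2l Lp (dD _ _ Zz Zx0).
    have := ler_wpM2l Lp (dD _ _ (Zw 0%N isT) (Zx 1%N isT)).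
    have := mulr_ge0 Lp (sqr_ge0 (enorm (z - x 1%N))).
    lra.
  have [am a'01 aE yE] := step k (ltnW kK).
  have [am' _ _ _] := step k.+1 kK.
  (* Tested at [w_(k+1)], the step together with convexity of [psi] and [momentum_step] multiplies
     the potential by at most [1 - alpha_(k+1)], the ratio of consecutive [alpha^2]. *)
  have := prox_step am' (Zw _ kK).
  rewrite (momentum_step z (mom _ (leqW (ltnW kK))).1 a'01 aE yE) -/(w k) aE.
  have := psi_convex t (x k.+1) z cvxf cvxh (a01 _ kK); rewrite -/(w k.+1).
  have b0 : 0 <= 1 - alpha k.+1 by rewrite subr_ge0; case/andP: (a01 _ kK).
  have := ler_wpM2l b0 (IH (ltnW kK)); lra.
have := pot K (leqnn _); have [aK0 aK] := mom K (ltnW (leqnn _)).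
(* After [K + 1] steps the bound involves [alpha_K <= 2 / (K + 4)], relaxed to [2 / (K + 1)]; hence
   [16 = 4 * 4]. *)
have : (alpha K * K.+1%:R) ^+ 2 <= 2 ^+ 2.
  rewrite lerXn2r ?nnegrE ?(mulr_ge0 (ltW aK0))//; apply: le_trans aK.
  by rewrite ler_pM2l// -[K.+1%:R]natr1; lra.
have := mulr_ge0 L0 (sqr_ge0 D).
have := mulr_ge0 L0 (sqr_ge0 (enorm (w K - x K.+1))).
move: (K.+1%:R : R) => m; rewrite exprMn => H1 H2 H3 H4.
have {}H4 : psi f h t (x K.+1) - psi f h t z <= 4 * L * D ^+ 2 * alpha K ^+ 2.
  lra.
have := ler_wpM2l (sqr_ge0 m) H4; have := ler_wpM2l H2 H3; lra.
Qed.

(** Positive root of [a'^2 + a^2 a' - a^2 = 0]. *)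
Lemma momentum_exists (a : R) : 0 < a ->
  exists a', 0 < a' < 1 /\ a' ^+ 2 = (1 - a') * a ^+ 2.
Proof.
move=> a0; set s := Num.sqrt (a ^+ 4 + 4 * a ^+ 2).
have a2 : 0 < a ^+ 2 by rewrite exprn_gt0.
have s2 : s ^+ 2 = a ^+ 4 + 4 * a ^+ 2.
  by rewrite sqr_sqrtr// addr_ge0 ?exprn_ge0 ?mulr_ge0 ?ltW.
have s0 : 0 <= s := sqrtr_ge0 _.
have s1 : a ^+ 2 < s.
  rewrite -(@ltr_pXn2r _ 2)// ?nnegrE ?ltW// s2 -exprM; lra.
have s3 : s < a ^+ 2 + 2.
  rewrite -(@ltr_pXn2r _ 2)// ?nnegrE ?addr_ge0 ?ltW// s2 sqrrD -exprM; lra.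
exists ((s - a ^+ 2) / 2); split; first by lra.
have -> : ((s - a ^+ 2) / 2) ^+ 2 =
  (s ^+ 2 - 2 * s * a ^+ 2 + a ^+ 4) / 4 by field.
by rewrite s2; field.
Qed.

Lemma sm_subroutine_exists t K x0 : Z x0 ->
  exists out, sm_subroutine f h Z Lf Lh K t x0 out.
Proof.
move=> Zx0.
have /choice[F FP] : forall y, exists p, argmin_set Z (psi_model f h L t y) p.
  move=> y; apply: argmin_set_nonempty => //; first by exists x0.
  have ch : continuous (quad_model L h y : _ -> R^o).
    exact: quad_model_continuous.
  have cf : continuous ((quad_model L f y : _ -> R^o) - cst t).
    move=> x; apply: continuousB; last exact: cst_continuous.
    exact: quad_model_continuous.
  by move=> x; exact: (continuous_max (cf x) (ch x)).
have /choice[A AP] : forall a : R, exists a', 0 < a ->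
    0 < a' < 1 /\ a' ^+ 2 = (1 - a') * a ^+ 2.
  move=> a; have [a0|] := pselect (0 < a); last by exists 0.
  by have [a' H] := momentum_exists a0; exists a'.
pose alpha k := iter k A (1 / 2).
have alpha0 k : 0 < alpha k.
  elim: k => [|k IH]; first by rewrite /alpha/=; lra.
  by have [/andP[]] := AP _ IH.
pose beta k := alpha k * (1 - alpha k) / (alpha k ^+ 2 + alpha k.+1).
(* The recursion carries the pair [(x_k, y_k)]: the step starts from [y_k], the extrapolation also
   uses [x_k]. *)
pose xy := fix xy k := if k is k'.+1 then
  let x' := F (xy k').2 in (x', x' + beta k' *: (x' - (xy k').1)) else (x0, x0).
exists (xy K).1, (fun k => (xy k).1), (fun k => (xy k).2), alpha.
split=> // k _; have [a1 a2] := AP _ (alpha0 k); split=> //; exact: FP.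
Qed.

End Accelerated_method.

(** * From subroutine accuracy to weak optimality and iteration counts *)

Section Complexity.
Context {R : realType} {n : nat}.
Variables (f g : 'rV[R]_n -> R) (Z : set 'rV[R]_n) (ef eg l : R).
Variables (xg x0 : 'rV[R]_n).
Hypotheses (cf : continuous (f : 'rV[R]_n -> R^o)).
Hypotheses (cg : continuous (g : 'rV[R]_n -> R^o)).
Hypotheses (cmpZ : compact Z) (ef0 : 0 < ef) (eg0 : 0 < eg) (Zxg : Z xg).
Hypothesis gxg : g xg <= gstar g Z + eg / 2.
Hypothesis Zx0 : Z x0.
Local Notation h := (fun x : 'rV[R]_n => ef / eg * (g x - g xg)).
Local Notation u := (f xg).
Local Notation feasible := [set x | Z x /\ g x - g xg <= 0].
Hypothesis l_le : l <= min_on feasible f.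

Lemma feasible_argmin_nonempty : argmin_set feasible f !=set0.
Proof.
apply: argmin_set_nonempty => //; first by exists xg; rewrite /= subrr.
rewrite (_ : feasible = Z `&` g @^-1` [set r | r <= g xg]).
  apply: compact_closedI => //; apply: closed_comp; last exact: closed_le.
  by move=> x _; exact: cg.
by apply/seteqP; split=> x /= [Zx]; rewrite subr_le0.
Qed.

(** Minimizers of [g] satisfy [g <= g xg], so relaxing the constraint only lowers the optimal
    value. *)
Lemma feasible_min_le_fstar xF :
  argmin_set feasible f xF -> f xF <= fstar f g Z.
Proof.
move=> [_ xFmin]; apply: lb_le_inf.
  have [p Hp] := argmin_set_nonempty (ex_intro _ xg Zxg) cmpZ cg.
  by exists (f p), p.
by move=> _ [w [Zw gw] <-]; apply: xFmin; split=> //; rewrite subr_le0 gw.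
Qed.

Lemma bisection_weak_optimal sub out :
  (forall t x y, Z x -> sub t x y -> Z y /\
     forall z, Z z -> psi f h t y <= psi f h t z + ef / 2) ->
  bisection f h ef sub (bisection_count l u ef) l u x0 xg out ->
  weak_optimal f g Z ef eg out.
Proof.
move=> subP run; have [xF xFmin] := feasible_argmin_nonempty.
have lF : l <= f xF by rewrite -(min_on_argmin xFmin).
have [[ZF gF] minF] := xFmin.
have Fu : f xF <= u by apply: minF; split=> //=; rewrite subrr.
have hF : h xF <= 0 by rewrite /= pmulr_rle0// divr_gt0.
have [||fout hout] := bisection_correct ZF hF _ run Zx0 lF _.
- by move=> t x y Zx /(subP _ _ _ Zx)[Zy yP]; split=> //; exact: yP.
(* The invariant holds at the start, as [psi u xg = 0] for [u = f xg]. *)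
- by rewrite /psi !subrr mulr0 maxxx divr_ge0// ltW.
have {}fout : f out <= f xF + ef.
  rewrite (le_trans fout)// [ef in leRHS]splitr addrA !lerD2r lerD2l.
  exact: bisection_count_ge ef0 (le_trans lF Fu).
split; first by have := feasible_min_le_fstar xFmin; lra.
(* Undoing the scaling by [ef / eg] turns the tolerance [ef / 2] into [eg / 2]. *)
have : g out - g xg <= eg / 2.
  rewrite -(ler_pM2l (divr_gt0 ef0 eg0)) (le_trans hout)//.
  by rewrite mulrA divfK ?lt0r_neq0.
move=> gout; have := gxg; lra.
Qed.

(** The constant is [14 = 2 * 7]: the number of rounds is at most [2 (1 + ln (1 + rho))], and
    [floor (6 m) + 1 <= 7 m] because [m >= 1]. *)
Lemma complexity_of_rate X (run : nat -> 'rV[R]_n -> Prop) :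
  (forall K out, (0 < K)%N -> 6 * Num.max 1 X <= K%:R -> run K out ->
     weak_optimal f g Z ef eg out) ->
  complexity_le run (weak_optimal f g Z ef eg) (bisection_count l u ef)
    (softO 14 ((u - l) / ef) X).
Proof.
move=> rate; set m := Num.max 1 X; have m1 : 1 <= m by rewrite le_max lexx.
have m6 : 0 <= 6 * m by lra.
have /andP[K0le K0gt] := truncn_itv m6.
exists (Num.truncn (6 * m)).+1; split=> //; last first.
  move=> K out KK; apply: rate; first exact: leq_trans KK.
  by rewrite (le_trans (ltW K0gt))// ler_nat.
have [xF xFmin] := feasible_argmin_nonempty.
have lu : l <= u.
  rewrite (le_trans l_le)// (min_on_argmin xFmin); apply: xFmin.2.
  by split=> //=; rewrite subrr.
have k7 : (Num.truncn (6 * m)).+1%:R <= 7 * m.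
  rewrite -natr1; move: (Num.truncn _)%:R K0le => k k6; lra.
rewrite natrM /softO -/m.
have -> b : 14 * (1 + b) * m = (2 * (1 + b)) * (7 * m) by ring.
exact: ler_pM (ler0n _ _) (ler0n _ _) (bisection_count_le ef0 lu) k7.
Qed.

End Complexity.

(** * Iterations per round that ensure accuracy [ef / 2] *)

Section Rates.
Context {R : realType}.
Implicit Types (a b ef eg D X K p : R).

(** The scaling balances the two constants: [ef / eg * Cg] relative to [ef] is [Cg / eg]. *)
Lemma scaled_max_sqr_le Cf Cg ef eg : 0 < ef -> 0 < eg ->
  0 <= Cf -> 0 <= Cg ->
  Num.max Cf (ef / eg * Cg) ^+ 2 <=
  ef ^+ 2 * Num.max (Cf ^+ 2 / ef ^+ 2) (Cg ^+ 2 / eg ^+ 2).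
Proof.
move=> ef0 eg0 Cf0 Cg0.
have ef2 : 0 < ef ^+ 2 by rewrite exprn_gt0.
rewrite -ler_pdivrMl// le_max.
have [_|_] := leP Cf (ef / eg * Cg); apply/orP; [right|left].
  by rewrite le_eqVlt; apply/orP; left; apply/eqP; field; rewrite !lt0r_neq0.
by rewrite mulrC.
Qed.

Lemma scaled_max_le Lf Lg ef eg : 0 < ef -> 0 < eg -> 0 <= Lf -> 0 <= Lg ->
  Num.max Lf (ef / eg * Lg) <=
  ef * Num.max (Num.sqrt (Lf / ef)) (Num.sqrt (Lg / eg)) ^+ 2.
Proof.
move=> ef0 eg0 Lf0 Lg0; rewrite -ler_pdivrMl//.
have M0 : 0 <= Num.max (Num.sqrt (Lf / ef)) (Num.sqrt (Lg / eg)).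
  by rewrite le_max sqrtr_ge0.
have [_|_] := leP Lf (ef / eg * Lg).
  have -> : ef^-1 * (ef / eg * Lg) = Num.sqrt (Lg / eg) ^+ 2.
    by rewrite sqr_sqrtr ?divr_ge0 ?(ltW eg0)//; field; rewrite !lt0r_neq0.
  by rewrite lerXn2r// ?nnegrE ?sqrtr_ge0// le_max lexx orbT.
have -> : ef^-1 * Lf = Num.sqrt (Lf / ef) ^+ 2.
  by rewrite sqr_sqrtr ?divr_ge0 ?(ltW ef0)// mulrC.
by rewrite lerXn2r// ?nnegrE ?sqrtr_ge0// le_max lexx.
Qed.

Lemma lip_rate C M D ef K p : 0 < ef -> 0 < K -> 0 <= C -> 0 <= D ->
  C ^+ 2 <= ef ^+ 2 * M -> 6 * Num.max 1 (M * D ^+ 2) <= K ->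
  K * p <= D * C * Num.sqrt K -> p <= ef / 2.
Proof.
move=> ef0 K0 C0 D0 CM; set m := Num.max _ _ => mK Kp.
have Xm : M * D ^+ 2 <= m by rewrite /m le_max lexx orbT.
have q0 : 0 < Num.sqrt K by rewrite sqrtr_gt0.
have q2 : Num.sqrt K ^+ 2 = K by rewrite sqr_sqrtr ?ltW.
have DC : D * C <= ef / 2 * Num.sqrt K.
  rewrite -(@ler_pXn2r _ 2)// ?nnegrE ?mulr_ge0 ?invr_ge0
    ?(ltW ef0) ?(ltW q0)//.
  rewrite !exprMn q2.
  have := ler_wpM2r (sqr_ge0 D) CM; have e2 := sqr_ge0 ef.
  have := ler_wpM2l e2 Xm; have := ler_wpM2l e2 mK.
  have := mulr_ge0 e2 (ltW K0); lra.
rewrite -(ler_pM2l K0) (le_trans Kp)// -{2}q2.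
by have := ler_wpM2r (ltW q0) DC; lra.
Qed.

(** Since [K >= 6 M D], the gap is at most [16 / 36] of [ef]; this estimate dictates the 6, the
    subgradient rate being content with 4. *)
Lemma sm_rate L M D ef K p : 0 < ef -> 0 < K -> 0 <= M -> 0 <= D ->
  L <= ef * M ^+ 2 -> 6 * Num.max 1 (M * D) <= K ->
  K ^+ 2 * p <= 16 * L * D ^+ 2 -> p <= ef / 2.
Proof.
move=> ef0 K0 M0 D0 LM; set m := Num.max _ _ => mK Kp.
have Xm : M * D <= m by rewrite /m le_max lexx orbT.
have XK : (6 * (M * D)) ^+ 2 <= K ^+ 2.
  by rewrite lerXn2r ?nnegrE ?mulr_ge0 ?(ltW K0)//; lra.
rewrite -(ler_pM2l (exprn_gt0 2 K0)) (le_trans Kp)//.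
rewrite !exprMn in XK.
have := ler_wpM2r (sqr_ge0 D) LM; have := ler_wpM2l (ltW ef0) XK.
have := mulr_ge0 (ltW ef0) (sqr_ge0 K); lra.
Qed.

End Rates.

(** * Both complexity bounds, and existence of runs *)

Unset Implicit Arguments.

Theorem corollary5p1 (R : realType) :
  exists c : R, 0 < c /\
  forall (n : nat) (f g : 'rV[R]_n -> R) (Z : set 'rV[R]_n) (D ef eg : R)
         (xg x0 : 'rV[R]_n) (l : R),
    convex_function setT f -> convex_function setT g ->
    continuous (f : 'rV[R]_n -> R^o) -> continuous (g : 'rV[R]_n -> R^o) ->
    convex_set Z -> compact Z -> D = diameter Z ->
    0 < ef -> 0 < eg ->
    Z xg -> gstar g Z <= g xg <= gstar g Z + eg / 2 ->
    Z x0 ->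
    let tg := fun x : 'rV[R]_n => g x - g xg in
    let h := fun x : 'rV[R]_n => ef / eg * tg x in
    let u := f xg in
    l <= min_on [set x | Z x /\ tg x <= 0] f ->
    let N := bisection_count l u ef in
    (forall Cf Cg : R, 0 <= Cf -> 0 <= Cg ->
       lipschitz_in Z Cf f -> lipschitz_in Z Cg g ->
       let run := fcbio_lip f h Z D Cf (ef / eg * Cg) ef l u x0 xg in
       complexity_le run (weak_optimal f g Z ef eg) N
         (softO c ((u - l) / ef)
            (Num.max (Cf ^+ 2 / ef ^+ 2) (Cg ^+ 2 / eg ^+ 2) * D ^+ 2)) /\
       ((forall x, Z x -> exists s, bounded_subgradient Cf f x s) ->
        (forall x, Z x -> exists s, bounded_subgradient Cg g x s) ->
        forall K : nat, (0 < K)%N -> exists out, run K out))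
    /\
    (forall Lf Lg : R, 0 <= Lf -> 0 <= Lg ->
       smooth Lf f -> smooth Lg g ->
       let run := fcbio_sm f h Z Lf (ef / eg * Lg) ef l u x0 xg in
       complexity_le run (weak_optimal f g Z ef eg) N
         (softO c ((u - l) / ef)
            (Num.max (Num.sqrt (Lf / ef)) (Num.sqrt (Lg / eg)) * D)) /\
       (forall K : nat, (0 < K)%N -> exists out, run K out)).
Proof.
exists 14; split=> // n f g Z D ef eg xg x0 l cvxf cvxg cf cg cvxZ cmpZ ->.
move=> ef0 eg0 Zxg /andP[_ gxg] Zx0 tg h u lF N.
have k0 : 0 < ef / eg by rewrite divr_gt0.
have cvxh : convex_function setT h by apply: convex_affine => //; exact: ltW.
have D0 : 0 <= diameter Z by exact: diameter_ge0 cmpZ Zxg.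
split=> [Cf Cg Cf0 Cg0 _ _|Lf Lg Lf0 Lg0 smf smg] run; split.
- apply: complexity_of_rate => // K out K0 KX.
  apply: bisection_weak_optimal => // t x y Zx sxy.
  have [Zy gap] := lip_subroutine_gap cvxZ cmpZ cvxf cvxh K0 Zx sxy.
  split=> // z Zz; rewrite -lerBlDl.
  have C0 : 0 <= Num.max Cf (ef / eg * Cg) by rewrite le_max Cf0.
  have CM := scaled_max_sqr_le ef0 eg0 Cf0 Cg0.
  apply: (lip_rate ef0 _ C0 D0 CM KX (gap z Zz)).
  by rewrite ltr0n.
- move=> sf sg K K0; apply: bisection_exists Zx0 _ _ => t x.
    move=> Zx; apply: lip_subroutine_exists => // y /sg[s [ss sC]].
    (* A subgradient of [g] times [ef / eg] is one of [h], and the norm bound scales likewise. *)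
    exists ((ef / eg) *: s); split.
      move=> z; rewrite /h /tg dotpZl -mulrDr ler_pM2l//; have := ss z; lra.
    by rewrite enormZ gtr0_norm// ler_pM2l.
  by move=> y Zx /(lip_subroutine_gap cvxZ cmpZ cvxf cvxh K0 Zx)[].
- have smh : smooth (ef / eg * Lg) h.
    by rewrite -{1}(gtr0_norm k0); exact: smooth_affine.
  apply: complexity_of_rate => // K out K0 KX.
  apply: bisection_weak_optimal => // t x y Zx sxy.
  have [Zy gap] := sm_subroutine_gap cvxZ cmpZ cvxf cvxh smf smh Lf0 K0 Zx sxy.
  split=> // z Zz; rewrite -lerBlDl.
  apply: (sm_rate ef0 _ _ D0 (scaled_max_le ef0 eg0 Lf0 Lg0) KX (gap z Zz)).
    by rewrite ltr0n.
  by rewrite le_max sqrtr_ge0.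
- move=> K K0.
  have smh : smooth (ef / eg * Lg) h.
    by rewrite -{1}(gtr0_norm k0); exact: smooth_affine.
  apply: bisection_exists Zx0 _ _ => t x.
    by move=> Zx; apply: sm_subroutine_exists.
  by move=> y Zx /(sm_subroutine_gap cvxZ cmpZ cvxf cvxh smf smh Lf0 K0 Zx)[].
Qed.
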